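(* Let $G_1,G_2$ be finite simple graphs (without isolated vertices) with $E(G_1)\cap E(G_2)=\varnothing$, and let $G_1\sqcup_E G_2$ be their edge-disjoint union. Then \[\lambda_{\max}(G_1\sqcup_E G_2)\leq\max\{\lambda_{\max}(G_1),\lambda_{\max}(G_2)\}.\]
   Context: The edge-disjoint union $G_1\sqcup_E G_2$ of graphs with $E(G_1)\cap E(G_2)=\varnothing$ (whose vertex sets may overlap) has vertex set $V(G_1)\cup V(G_2)$ and edge set $E(G_1)\sqcup E(G_2)$. $\lambda_{\max}(H)$ denotes the largest eigenvalue of the normalized Laplacian $L=\mathrm{Id}-D^{-1}A$ of a graph $H$. *)

(* Defs.v *)
From HB Require Import structures.
From mathcomp Require Import all_boot all_order all_algebra.
From mathcomp Require Import polyorder polyrcf.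
From mathcomp Require classical_sets.
From mathcomp Require Import reals.

Set Implicit Arguments.
Unset Strict Implicit.
Unset Printing Implicit Defensive.

Import Order.TTheory GRing.Theory Num.Theory.

Local Open Scope ring_scope.

(* Graphs whose vertex sets may overlap share an ambient finite type T, which
   may be larger than the vertex set of any of them.  An edge is a two-element
   set of vertices. *)
Record sgraph (T : finType) := SGraph {
  vertices : {set T};
  edges : {set {set T}};
  edgesP : forall e, e \in edges -> #|e| = 2%N /\ e \subset vertices
}.

Section Graph.
Variables (T : finType) (G : sgraph T).

Definition adj : rel T := fun x y => [set x; y]%SET \in edges G.

Definition degree (x : T) : nat := #|[set y | adj x y]|.

Definition no_isolated : Prop :=
  forall x, x \in vertices G -> (0 < degree x)%N.

Lemma adj_neq x y : adj x y -> x != y.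
Proof. by move=> /edgesP[]; rewrite cards2; case: (x != y). Qed.

Lemma adj_vertices x y : adj x y -> x \in vertices G /\ y \in vertices G.
Proof.
by move=> /edgesP[_ /subsetP sV]; split; apply: sV; rewrite !inE eqxx ?orbT.
Qed.

Lemma adj_sym : symmetric adj.
Proof. by move=> x y; rewrite /adj setUC. Qed.

End Graph.

Lemma edge_union_subproof (T : finType) (G1 G2 : sgraph T) (e : {set T}) :
  e \in edges G1 :|: edges G2 ->
  #|e| = 2%N /\ e \subset vertices G1 :|: vertices G2.
Proof.
rewrite inE => /orP[] /edgesP[-> sV]; split=> //; apply: subset_trans sV _.
  exact: subsetUl.
exact: subsetUr.
Qed.

(* Meant for graphs with disjoint edge sets; disjointness is not needed for
   the union to be a simple graph. *)
Definition edge_union (T : finType) (G1 G2 : sgraph T) : sgraph T :=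
  SGraph (@edge_union_subproof T G1 G2).

Section Laplacian.
Import classical_sets.
Variables (R : realType) (T : finType) (G : sgraph T).

(* Rows and columns are indexed by the vertices of G only, enumerated by
   enum_val, and not by all of T. *)
Definition adjacency_mx : 'M[R]_#|vertices G| :=
  \matrix_(i, j) (adj G (enum_val i) (enum_val j))%:R.

Definition degree_mx : 'M[R]_#|vertices G| :=
  diag_mx (\row_i (degree G (enum_val i))%:R).

Definition laplacian : 'M[R]_#|vertices G| :=
  1%:M - invmx degree_mx *m adjacency_mx.

(* By lambda_maxP, this supremum is a maximum for every graph with at least one
   vertex and no isolated vertex; for the graph with no vertices it is 0.  Row
   eigenvectors, as in [eigenvalue], give the same spectrum as column ones. *)
Definition lambda_max : R := sup [set a | eigenvalue laplacian a]%classic.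

Lemma degreeE (i : 'I_#|vertices G|) :
  \sum_(j < #|vertices G|) (adj G (enum_val i) (enum_val j))%:R
    = (degree G (enum_val i))%:R :> R.
Proof.
rewrite /degree -[in RHS]sum1_card natr_sum.
rewrite -(big_enum_val (fun y => (adj G (enum_val i) y)%:R)) /=.
rewrite big_mkcond [RHS]big_mkcond; apply: eq_bigr => y _; rewrite inE.
by case: ifP; case: (boolP (adj _ _ y)) => // /adj_vertices[_ ->].
Qed.

Lemma laplacian_const : no_isolated G -> laplacian *m (const_mx 1 : 'cV_ _) = 0.
Proof.
move=> niG; have uD : degree_mx \in unitmx.
  rewrite unitmxE det_diag unitfE; apply/prodf_neq0 => i _.
  by rewrite mxE pnatr_eq0 -lt0n; apply/niG/enum_valP.
rewrite mulmxBl mul1mx -mulmxA.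
suff -> : adjacency_mx *m const_mx 1 = degree_mx *m (const_mx 1 : 'cV_ _).
  by rewrite mulKmx // subrr.
apply/colP => i; rewrite mul_diag_mx !mxE mulr1 -degreeE.
by apply: eq_bigr => j _; rewrite !mxE mulr1.
Qed.

Lemma eigenvalue0_laplacian :
  no_isolated G -> vertices G != finset.set0 -> eigenvalue laplacian 0.
Proof.
move=> niG /set0Pn[x xV].
rewrite /eigenvalue /eigenspace raddf0 subr0 kermx_eq0 row_free_unit.
apply/negP => uL; have := congr1 (mulmx (invmx laplacian)) (laplacian_const niG).
rewrite mulKmx // mulmx0 => /colP/(_ (enum_rank_in xV x)).
by rewrite !mxE => /eqP; rewrite oner_eq0.
Qed.

Lemma lambda_maxP : no_isolated G -> vertices G != finset.set0 ->
  eigenvalue laplacian lambda_max /\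
  forall a, eigenvalue laplacian a -> a <= lambda_max.
Proof.
move=> niG VG; have p0 : char_poly laplacian != 0.
  exact/monic_neq0/char_poly_monic.
set s := rootsR (char_poly laplacian).
have sE a : eigenvalue laplacian a = (a \in s).
  by rewrite eigenvalue_root_char -(roots_on_rootsR p0) in_itv.
have s0 : 0 \in s by rewrite -sE eigenvalue0_laplacian.
pose m := \big[Num.max/0]_(a <- s) a.
have ub a : a \in s -> a <= m by move=> aS; exact: (@le_bigmax_seq _ _ _ _ _ a xpredT id).
have ms : m \in s.
  rewrite /m; rewrite big_seq; elim/big_ind : _ => // x y xs ys.
  by rewrite /Num.max; case: ifP.
suff -> : lambda_max = m by rewrite sE ms; split=> // a; rewrite sE; exact: ub.
apply/eqP; rewrite eq_le; apply/andP; split.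
  by apply: ge_sup; [exists m; rewrite /= sE|move=> a /=; rewrite sE; exact: ub].
apply: ub_le_sup; last by rewrite /= sE.
by exists m => a /=; rewrite sE; exact: ub.
Qed.

End Laplacian.

(* Main.v *)
(* Put q(f) = <f, (D - A) f> and m(f) = <f, D f>, so that the eigenvalues of the
   Laplacian are those of the pencil D - A - a D.  By the variational principle
   q(f) <= lambda_max m(f) for every f, with equality at some f with m(f) > 0.
   Both q and m are sums over edges, hence additive under edge-disjoint unions;
   evaluating at an extremal f of the union gives the bound. *)
Require Import Defs.
From HB Require Import structures.
From mathcomp Require Import all_boot all_order all_algebra.
From mathcomp Require classical_sets.
From mathcomp Require Import reals ring lra.

Import Order.TTheory GRing.Theory Num.Theory.
Local Open Scope ring_scope.

(** * Quadratic forms of matrices: boundedness, coercivity, Rayleigh quotients *)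

Definition qform {R : pzRingType} {n} (M : 'M[R]_n) (x : 'rV[R]_n) : R :=
  (x *m M *m x^T) 0 0.

Lemma qformE {R : comPzRingType} {n} (M : 'M[R]_n) (x : 'rV[R]_n) :
  qform M x = \sum_i \sum_j M i j * (x 0 i * x 0 j).
Proof.
rewrite /qform mxE exchange_big; apply: eq_bigr => j _.
rewrite !mxE big_distrl; apply: eq_bigr => i _ /=; ring.
Qed.

Lemma qformB {R : pzRingType} {n} (M N : 'M[R]_n) x :
  qform (M - N) x = qform M x - qform N x.
Proof. by rewrite /qform mulmxBr mulmxBl !mxE. Qed.

Lemma qformZ {R : comPzRingType} {n} a (M : 'M[R]_n) x :
  qform (a *: M) x = a * qform M x.
Proof. by rewrite /qform -scalemxAr -scalemxAl mxE. Qed.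

Lemma qform1E {R : comPzRingType} {n} (x : 'rV[R]_n) :
  qform 1%:M x = \sum_i x 0 i ^+ 2.
Proof.
by rewrite /qform mulmx1 mxE; apply: eq_bigr => i _; rewrite mxE expr2.
Qed.

Section RealForms.
Variables (R : realFieldType) (n : nat).
Implicit Types (M B : 'M[R]_n) (x : 'rV[R]_n).

Lemma qform1_ge0 x : 0 <= qform 1%:M x.
Proof. by rewrite qform1E sumr_ge0 // => i _; exact: sqr_ge0. Qed.

Lemma qform1_gt0 x : x != 0 -> 0 < qform 1%:M x.
Proof.
move=> x0; rewrite lt_def qform1_ge0 andbT qform1E.
apply: contraNneq x0 => /eqP; rewrite psumr_eq0 => [/allP h|i _]; last exact: sqr_ge0.
apply/eqP/rowP => i; rewrite mxE; apply/eqP.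
by have := h i (mem_index_enum i); rewrite sqrf_eq0.
Qed.

(** Each product of two coordinates is at most |x|^2, because 2ab <= a^2 + b^2. The summand 1 in the
    constant keeps it positive, so that it can be divided by. *)
Lemma qform_bounded M : exists2 C : R, 0 < C & forall x, qform M x <= C * qform 1%:M x.
Proof.
exists (1 + \sum_i \sum_j `|M i j|).
  by rewrite ltr_pwDl // sumr_ge0 // => i _; rewrite sumr_ge0.
move=> x; rewrite mulrDl mul1r; apply: ler_wpDl; first exact: qform1_ge0.
rewrite qformE big_distrl ler_sum // => i _; rewrite big_distrl ler_sum //= => j _.
have sq k : x 0 k ^+ 2 <= qform 1%:M x.
  rewrite qform1E (bigD1 k) //= lerDl sumr_ge0 // => l _; exact: sqr_ge0.
apply: le_trans (ler_norm _) _; rewrite normrM ler_wpM2l //.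
have := sq i; have := sq j; rewrite normrM -(real_normK (num_real (x 0 i))).
rewrite -(real_normK (num_real (x 0 j))).
move: (sqr_ge0 (`|x 0 i| - `|x 0 j|)); set a := `|x 0 i|; set b := `|x 0 j|; nra.
Qed.

(* With y = x B, |y|^2 = s and B <= C, nonnegativity of the form at x - y / C
   reads q(x) - 2 s / C + q(y) / C^2 >= 0, so that s <= C q(x). *)
Lemma psd_unit_coercive B : B^T = B -> (forall x, 0 <= qform B x) -> B \in unitmx ->
  exists2 c : R, 0 < c & forall x, c * qform 1%:M x <= qform B x.
Proof.
move=> symB psdB uB.
have [C C0 hC] := qform_bounded B.
(* The form of B^-1 B^-T takes the value |x|^2 at y = x B, so [C'] gives |x|^2 <= C' s; with s <= C
   q(x) this yields the constant 1 / (C C'). *)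
have [C' C'0 hC'] := qform_bounded (invmx B *m (invmx B)^T).
exists (C * C')^-1; first by rewrite invr_gt0 mulr_gt0.
move=> x; pose y := x *m B; pose s := qform 1%:M y.
have xs : qform 1%:M x <= C' * s.
  apply: le_trans (hC' y).
  by rewrite /qform mulmx1 mulmxA -mulmxA -trmx_mul /y mulmxK.
have sx : s <= C * qform B x.
  have xBy : (x *m B *m y^T) 0 0 = s by rewrite /s /qform mulmx1.
  have yBx : (y *m B *m x^T) 0 0 = s.
    by rewrite /s /qform mulmx1 /y !trmx_mul symB !mulmxA.
  have := psdB (x - C^-1 *: y); have := hC y; rewrite -/s.
  have -> : qform B (x - C^-1 *: y) = qform B x - 2 * C^-1 * s + C^-1 ^+ 2 * qform B y.
    have -> : qform B (x - C^-1 *: y) =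
        ((x - C^-1 *: y) *m B *m (x^T - C^-1 *: y^T)) 0 0.
      by rewrite /qform [(x - _)^T]linearB /= [(_ *: y)^T]linearZ.
    rewrite /qform !mulmxBl -!scalemxAl !mulmxBr -!scalemxAr.
    move: xBy yBx; rewrite !mxE => -> ->; ring.
  set q := qform B x; set r := qform B y => hr h.
  have h1 : C^-1 ^+ 2 * r <= C^-1 * s.
    have -> : C^-1 * s = C^-1 ^+ 2 * (C * s) by field; rewrite gt_eqF.
    by rewrite ler_wpM2l // sqr_ge0.
  have : C^-1 * s <= q by lra.
  by rewrite mulrC ler_pdivrMr // mulrC.
rewrite ler_pdivrMl ?mulr_gt0 //.
by apply: le_trans xs _; rewrite -mulrA mulrCA ler_pM2l.
Qed.

End RealForms.

(* At the supremum m of the Rayleigh quotients the form m D - K is nonnegative;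
   were it invertible it would be coercive, and m could be lowered. *)
Lemma rayleigh_max (R : realType) n (K D : 'M[R]_n) : (0 < n)%N ->
  K^T = K -> D^T = D -> (forall x, 0 <= qform D x) -> D \in unitmx ->
  exists2 m : R, m *: D - K \notin unitmx & forall x, qform K x <= m * qform D x.
Proof.
move=> n0 symK symD psdD uD.
have [c c0 hc] := psd_unit_coercive R n D symD psdD uD.
have D_gt0 x : x != 0 -> 0 < qform D x.
  by move=> x0; apply: lt_le_trans (hc x); rewrite mulr_gt0 ?qform1_gt0.
pose S : classical_sets.set R := fun r => exists2 x, x != 0 & r = qform K x / qform D x.
have [C C0 hC] := qform_bounded R n K.
have S0 : classical_sets.nonempty S.
  have e0 : (const_mx 1 : 'rV[R]_n) != 0.
    apply/eqP => /rowP /(_ (Ordinal n0)) /eqP; by rewrite !mxE oner_eq0.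
  by eexists; exists (const_mx 1).
have ubS : classical_sets.has_ubound S.
  (* K(x) <= C |x|^2 <= (C / c) D(x). *)
  exists (C / c) => r [x x0 ->]; rewrite ler_pdivrMr ?D_gt0 //.
  apply: le_trans (hC x) _; rewrite -mulrA ler_pM2l //.
  by rewrite -ler_pdivrMl ?invr_gt0 // invrK.
have ub x : qform K x <= sup S * qform D x.
  have [->|x0] := eqVneq x 0; first by rewrite /qform !mul0mx !mxE mulr0.
  rewrite -ler_pdivrMr ?D_gt0 //; apply: ub_le_sup => //; by exists x.
exists (sup S) => //; apply/negP => uB.
have [||d d0 hd] := psd_unit_coercive R n _ _ _ uB.
- by rewrite linearB /= linearZ /= symK symD.
- by move=> x; rewrite qformB qformZ subr_ge0.
have [E E0 hE] := qform_bounded R n D.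
(* Since d |x|^2 >= (d / E) D(x), coercivity of [sup S *: D - K] makes [sup S - d / E] an upper
   bound of the quotients. *)
suff : sup S <= sup S - d / E by rewrite lerBrDr gerDl leNgt divr_gt0.
apply: ge_sup => // r [x x0 ->]; rewrite ler_pdivrMr ?D_gt0 //.
have := hd x; rewrite qformB qformZ mulrBl.
have : d / E * qform D x <= d * qform 1%:M x.
  by rewrite -mulrA ler_pM2l // mulrC ler_pdivrMr // mulrC.
lra.
Qed.

(** * Energy and mass of a graph, and the variational principle *)

Section Graph.
Variables (R : realType) (T : finType).
Implicit Types (G : sgraph T) (f : T -> R).

(** The Dirichlet energy: the two orientations of an edge together contribute (f x - f y)^2. Taking
    [f] on all of [T] lets one function serve several graphs. *)
Definition energy G f : R := \sum_x \sum_(y | adj G x y) (f x ^+ 2 - f x * f y).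

Definition mass G f : R := \sum_x \sum_(y | adj G x y) f x ^+ 2.

Lemma mass_ge0 G f : 0 <= mass G f.
Proof. by rewrite sumr_ge0 // => x _; rewrite sumr_ge0 // => y _; exact: sqr_ge0. Qed.

Lemma sum_adj_enum_val G (F : T -> T -> R) :
  \sum_x \sum_(y | adj G x y) F x y =
  \sum_(i < #|vertices G|) \sum_(j < #|vertices G|)
    (adj G (enum_val i) (enum_val j))%:R * F (enum_val i) (enum_val j).
Proof.
under [RHS]eq_bigr do rewrite -(big_enum_val (fun y => (adj G _ y)%:R * F _ y)) /=.
rewrite -(big_enum_val (fun x => \sum_(y in vertices G) (adj G x y)%:R * F x y)) /=.
rewrite [RHS]big_mkcond; apply: eq_bigr => x _.
case: ifPn => [xV|/negP xV]; last first.
  by rewrite big_pred0 // => y; apply/negP => /adj_vertices[].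
rewrite big_mkcond [RHS]big_mkcond; apply: eq_bigr => y _.
case: (boolP (adj G x y)) => [/adj_vertices[_ ->]|_]; first by rewrite mul1r.
by rewrite mul0r if_same.
Qed.

Lemma adjacency_mx_sym G : (adjacency_mx R G)^T = adjacency_mx R G.
Proof. by apply/matrixP => i j; rewrite !mxE adj_sym. Qed.

Lemma degree_mx_sym G : (degree_mx R G)^T = degree_mx R G.
Proof. exact: tr_diag_mx. Qed.

Lemma degree_mx_unit G : no_isolated G -> degree_mx R G \in unitmx.
Proof.
move=> niG; rewrite unitmxE det_diag unitfE; apply/prodf_neq0 => i _.
by rewrite mxE pnatr_eq0 -lt0n; apply/niG/enum_valP.
Qed.

Lemma qform_degree_mx G f :
  qform (degree_mx R G) (\row_i f (enum_val i)) = mass G f.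
Proof.
rewrite /mass sum_adj_enum_val qformE; apply: eq_bigr => i _.
rewrite -big_distrl /= degreeE (bigD1 i) //= big1 => [|j ji].
  by rewrite !mxE eqxx addr0 expr2.
by rewrite !mxE eq_sym (negPf ji) mul0r.
Qed.

Lemma qform_combinatorial_laplacian G f :
  qform (degree_mx R G - adjacency_mx R G) (\row_i f (enum_val i)) = energy G f.
Proof.
rewrite qformB qform_degree_mx /energy.
under [RHS]eq_bigr do rewrite big_split /=.
rewrite big_split /= -/(mass G f); congr (_ + _).
rewrite sum_adj_enum_val qformE -sumrN; apply: eq_bigr => i _.
by rewrite -sumrN; apply: eq_bigr => j _; rewrite !mxE mulrN.
Qed.

(** The substitution v = x D turns v (Id - D^-1 A) = a v into an equation between symmetric
    matrices, to which quadratic forms apply. *)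
Lemma eigenvalue_laplacianP G a : no_isolated G ->
  reflect (exists2 x : 'rV[R]_#|vertices G|,
             x *m (degree_mx R G - adjacency_mx R G) = a *: (x *m degree_mx R G) & x != 0)
          (eigenvalue (laplacian R G) a).
Proof.
move=> /degree_mx_unit uD; apply: (iffP eigenvalueP) => -[x xL x0].
  exists (x *m invmx (degree_mx R G)).
    rewrite mulmxBr mulmxKV // -mulmxA -xL /laplacian.
    by rewrite mulmxBr mulmx1.
  apply: contraNneq x0 => /(congr1 (mulmxr (degree_mx R G))) /=.
  by rewrite mulmxKV // mul0mx => ->.
exists (x *m degree_mx R G).
  by rewrite -xL /laplacian !mulmxBr mulmx1 mulmxA mulmxK.
apply: contraNneq x0 => /(congr1 (mulmxr (invmx (degree_mx R G)))) /=.
by rewrite mulmxK // mul0mx => ->.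
Qed.

(** The Rayleigh bound [m] makes m D - (D - A) singular; a kernel vector shows that [m] is an
    eigenvalue, hence at most [lambda_max]. *)
Lemma energy_le G f : no_isolated G -> energy G f <= lambda_max R G * mass G f.
Proof.
move=> niG; rewrite -qform_combinatorial_laplacian -qform_degree_mx.
have [G0|VG] := eqVneq (vertices G) set0.
  by rewrite !qformE !big1 ?mulr0 // => i _;
    have := in_set0 (enum_val i); rewrite -[in LHS]G0 enum_valP.
have psdD x : 0 <= qform (degree_mx R G) x.
  rewrite qformE sumr_ge0 // => i _; rewrite sumr_ge0 // => j _; rewrite !mxE.
  by case: (eqVneq i j) => [->|_]; rewrite ?mul0r // mulr_ge0 ?ler0n // -expr2 sqr_ge0.
have [|||m sing hm] :=
  rayleigh_max R _ (degree_mx R G - adjacency_mx R G) _ _ _ _ psdD (degree_mx_unit G niG).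
- by rewrite card_gt0.
- by rewrite linearB /= degree_mx_sym adjacency_mx_sym.
- exact: degree_mx_sym.
apply: le_trans (hm _) _; rewrite ler_wpM2r //.
apply: (proj2 (lambda_maxP R niG VG)); apply/eigenvalue_laplacianP => //.
move: sing; rewrite -row_free_unit -kermx_eq0 => /rowV0Pn[x /sub_kermxP xB x0].
by exists x => //; apply/eqP; rewrite eq_sym -subr_eq0 scalemxAr -mulmxBr xB.
Qed.

Lemma energy_extremal G : no_isolated G -> vertices G != set0 ->
  exists2 f, 0 < mass G f & energy G f = lambda_max R G * mass G f.
Proof.
move=> niG VG; have [/(eigenvalue_laplacianP G _ niG) [x xK x0] _] := lambda_maxP R niG VG.
have [y yV] := set0Pn _ VG.
(* Off the vertices [f] takes an irrelevant default value: energy and mass only see endpoints of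
   edges. *)
pose f z := x 0 (enum_rank_in yV z).
have xE : x = \row_i f (enum_val i).
  by apply/rowP => i; rewrite mxE /f enum_valK_in.
exists f; last first.
  rewrite -qform_combinatorial_laplacian -qform_degree_mx -xE.
  by rewrite /qform xK -scalemxAl mxE.
(* All degrees are at least 1, so the mass dominates |x|^2 > 0. *)
rewrite -qform_degree_mx -xE; apply: lt_le_trans (qform1_gt0 _ _ _ x0) _.
rewrite qform1E qformE ler_sum // => i _; rewrite (bigD1 i) //= big1 => [|j ji].
  rewrite !mxE eqxx addr0 expr2 mulr1n ler_peMl -?expr2 ?sqr_ge0 //.
  by rewrite ler1n; apply/niG/enum_valP.
by rewrite !mxE eq_sym (negPf ji) mul0r.
Qed.

(** In dimension 0 there is no nonzero vector, so the spectrum is empty, and its [sup] is 0 by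
    convention. *)
Lemma lambda_max_set0 G : vertices G = set0 -> lambda_max R G = 0.
Proof.
move=> G0; rewrite /lambda_max -[RHS](@sup0 R); congr sup.
rewrite -classical_sets.subset0 => a /= /eigenvalueP[x _ /eqP[]].
by apply/rowP => i; have := in_set0 (enum_val i); rewrite -[in LHS]G0 enum_valP.
Qed.

(** * Additivity over edge-disjoint unions *)

Section EdgeUnion.
Variables G1 G2 : sgraph T.

Lemma adj_edge_union x y : adj (edge_union G1 G2) x y = adj G1 x y || adj G2 x y.
Proof. by rewrite /adj inE. Qed.

Lemma no_isolated_edge_union :
  no_isolated G1 -> no_isolated G2 -> no_isolated (edge_union G1 G2).
Proof.
move=> ni1 ni2 x /setUP[/ni1|/ni2] /leq_trans; apply; apply: subset_leq_card;
  by apply/subsetP => y; rewrite !inE adj_edge_union => ->; rewrite ?orbT.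
Qed.

Hypothesis disjE : edges G1 :&: edges G2 = set0.

(** By disjointness, a pair adjacent in the union is adjacent in exactly one of the graphs; a shared
    edge would count twice on the right. *)
Lemma sum_adj_edge_union (F : T -> T -> R) :
  \sum_x \sum_(y | adj (edge_union G1 G2) x y) F x y =
  \sum_x \sum_(y | adj G1 x y) F x y + \sum_x \sum_(y | adj G2 x y) F x y.
Proof.
rewrite -big_split; apply: eq_bigr => x _ /=.
rewrite big_mkcond [in RHS]big_mkcond [X in _ = _ + X]big_mkcond -big_split /=.
apply: eq_bigr => y _; rewrite adj_edge_union.
have := in_set0 [set x; y]; rewrite -disjE inE -/(adj G1 x y) -/(adj G2 x y).
by case: adj; case: adj; rewrite //= ?addr0 ?add0r.
Qed.

End EdgeUnion.

End Graph.

Theorem theorem5p23 (R : realType) (T : finType) (G1 G2 : sgraph T)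
    (niG1 : no_isolated G1) (niG2 : no_isolated G2)
    (disjE : edges G1 :&: edges G2 = set0) :
  lambda_max R (edge_union G1 G2) <= Num.max (lambda_max R G1) (lambda_max R G2).
Proof.
have niG := no_isolated_edge_union T G1 G2 niG1 niG2.
have [G0|VG] := eqVneq (vertices (edge_union G1 G2)) set0.
  rewrite !lambda_max_set0 ?maxxx //; apply/eqP; rewrite -subset0 -G0.
    exact: subsetUr.
  exact: subsetUl.
have [f m0 fE] := energy_extremal R T _ niG VG.
(* After multiplication by the positive mass of [f], both sides split over [G1] and [G2], and
   [energy_le] applies to each at the same [f]. *)
rewrite -(ler_pM2r m0) -fE /energy /mass !sum_adj_edge_union // mulrDr.
by apply: lerD; apply: le_trans (energy_le _ _ _ _ _) _ => //;
  rewrite ler_wpM2r ?mass_ge0 // le_max lexx ?orbT.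
Qed.
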